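(* Let $X$ be a finite $T_0$-space (equivalently, a finite poset) and let $V\subseteq X$ be an open subset. Then $$\mu(X)=\mu(V)-\sum_{x\in X-V}\mu(\hat U_x).$$
   Context: Finite $T_0$-spaces are identified with finite posets; the open sets are the down-sets. $\hat U_x=\{a\in X:a<x\}$. The M\''obius function $\mu(P)$ of a finite poset $P$ is the number of chains of $P$ of odd cardinality minus the number of chains of $P$ of even cardinality, where the empty chain counts as a chain of even cardinality (equivalently, $\mu(P)$ is the reduced Euler characteristic of the order complex of $P$; in particular $\mu(\varnothing)=-1$). *)

(* Defs.v *)
From mathcomp Require Import all_boot all_order all_algebra.

Set Implicit Arguments.
Unset Strict Implicit.
Unset Printing Implicit Defensive.

Import Order.TTheory GRing.Theory Num.Theory.

Local Open Scope ring_scope.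

(* A finite T0-space is a finPOrderType X; its subspaces are the sets
   P : {set X} with the induced order. *)

Definition down_closed (d : Order.disp_t) (X : finPOrderType d) (V : {set X}) :
  Prop := forall x y : X, x \in V -> (y <= x)%O -> y \in V.

Definition is_chain (d : Order.disp_t) (X : finPOrderType d) (c : {set X}) :
  bool := [forall x in c, forall y in c, (x >=< y)%O].

Definition chains (d : Order.disp_t) (X : finPOrderType d) (P : {set X}) :
  {set {set X}} := [set c : {set X} | (c \subset P) && is_chain c].

(* set0 is a chain, so the empty chain is among the even ones. *)
Definition mobius (d : Order.disp_t) (X : finPOrderType d) (P : {set X}) :
  int := #|[set c in chains P | odd #|c| ]|%:Z
         - #|[set c in chains P | ~~ odd #|c| ]|%:Z.

Definition Uhat (d : Order.disp_t) (X : finPOrderType d) (x : X) : {set X} :=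
  [set a : X | (a < x)%O].

(* Main.v *)
Require Import Defs.
From mathcomp Require Import all_boot all_order all_algebra.
Import Order.TTheory GRing.Theory Num.Theory.
Local Open Scope ring_scope.

(** The number [mobius P] is a signed count of the chains of [P], a chain [c]
    having weight [(-1) ^+ #|c|.+1].  The chains of [X] split into those lying
    in [V], which contribute [mobius V], and the others.  A chain [c] not
    contained in [V] is nonempty, hence has a greatest element [x], and [x] is
    outside [V] because [V] is closed downwards.  Conversely a chain whose
    greatest element is outside [V] is not contained in [V].  So the remaining
    chains are classified by their greatest element [x], which ranges over the
    complement of [V].  Deleting [x] is a bijection from the chains with
    greatest element [x] to the chains of [Uhat x]; it changes the parity of
    the cardinality, so this class contributes [- mobius (Uhat x)]. *)

Section ChainSums.
Context {d : Order.disp_t} {X : finPOrderType d}.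
Implicit Types (x y : X) (c P V : {set X}).

Definition chain_weight c : int := (-1) ^+ #|c|.+1.

Definition is_greatest x c : bool := (x \in c) && [forall y in c, (y <= x)%O].

(** Chains of odd and even cardinality are merged into one signed sum, in which
    they can be reindexed together. *)
Lemma mobius_sum P : mobius P = \sum_(c in chains P) chain_weight c.
Proof.
rewrite (bigID (fun c : {set X} => odd #|c|)) /= /mobius.
have natz_card (A : {set {set X}}) : #|A|%:Z = \sum_(c in A) 1.
  by rewrite sumr_const natz.
rewrite !natz_card -sumrN; congr (_ + _); apply: eq_big => c; rewrite ?inE //.
  by move=> /andP[_ odd_c]; rewrite /chain_weight exprS -signr_odd odd_c mulrNN.
by move=> /andP[_ /negbTE odd_c]; rewrite /chain_weight exprS -signr_odd odd_c.
Qed.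

Lemma chainP c :
  reflect {in c &, forall x y, (x >=< y)%O} (is_chain c).
Proof.
apply: (iffP 'forall_in_forall_inP) => cmp x; first by move=> y xc; apply: cmp.
by move=> xc y; apply: cmp.
Qed.

Lemma greatest_uniq {x y c} : is_greatest x c -> is_greatest y c -> x = y.
Proof.
move=> /andP[xc /forall_inP le_x] /andP[yc /forall_inP le_y].
by apply/le_anti; rewrite le_x ?le_y.
Qed.

(** An element of a chain with the most elements of the chain below it is the
    greatest one: an element not below it would be above it, and so would have
    strictly more elements below. *)
Lemma chain_has_greatest {c} :
  is_chain c -> c != set0 -> exists x, is_greatest x c.
Proof.
move=> /chainP cmp /set0Pn[x0 x0c].
pose below x := [set y in c | (y <= x)%O].
case: (@arg_maxnP _ x0 (mem c) (fun x => #|below x|) x0c) => x xc max_x.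
exists x; apply/andP; split=> //; apply/forall_inP => y yc.
have /orP[le_xy|//] := cmp x y xc yc.
apply/contraT => nle_yx; have /= := max_x y yc; rewrite leqNgt => /negP[].
apply/proper_card/properP; split.
  apply/subsetP => z; rewrite !inE => /andP[-> le_zx].
  exact: le_trans le_zx le_xy.
by exists y; rewrite !inE yc ?lexx.
Qed.

Lemma add_top_chain {x c} :
  c \in chains (Uhat x) -> is_chain (x |: c).
Proof.
rewrite inE => /andP[/subsetP c_lt /chainP cmp]; apply/chainP => y z.
have lt_x t : t \in c -> (t < x)%O by move/c_lt; rewrite inE.
rewrite !inE => /predU1P[->|yc] /predU1P[->|zc]; rewrite ?comparablexx //.
- by rewrite comparable_sym lt_comparable ?lt_x.
- by rewrite lt_comparable ?lt_x.
- exact: cmp.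
Qed.

Lemma del_top_chain {x c} :
  is_chain c -> is_greatest x c -> c :\ x \in chains (Uhat x).
Proof.
move=> /chainP cmp /andP[_ /forall_inP le_x]; rewrite inE; apply/andP; split.
  apply/subsetP => y /setD1P[neq_yx yc].
  by rewrite inE lt_neqAle neq_yx le_x.
by apply/chainP => y z /setD1P[_ yc] /setD1P[_ zc]; apply: cmp.
Qed.

(** Deleting the greatest element [x], with inverse adding it back, leaves an
    arbitrary chain of [Uhat x]; the sign comes from the change of parity. *)
Lemma sum_chains_greatest x :
  \sum_(c | is_chain c && is_greatest x c) chain_weight c = - mobius (Uhat x).
Proof.
rewrite mobius_sum -sumrN.
rewrite (reindex_onto (fun c => x |: c) (fun c => c :\ x)) /=; last first.
  by move=> c /and3P[_ xc _]; rewrite setD1K.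
apply: eq_big => [c|c].
  apply/idP/idP.
    by move=> /andP[/andP[cc gr] /eqP <-]; apply: del_top_chain.
  move=> cU; have lt_x y : y \in c -> (y < x)%O.
    by move: cU; rewrite inE => /andP[/subsetP sub _ /sub]; rewrite inE.
  have xNc : x \notin c by apply/negP => /lt_x; rewrite ltxx.
  rewrite add_top_chain // setU1K // eqxx /is_greatest setU11 /= andbT.
  by apply/forall_inP => y /setU1P[-> //|/lt_x/ltW].
move=> /andP[_ /eqP eq_c]; have xNc : x \notin c by rewrite -eq_c !inE eqxx.
by rewrite /chain_weight cardsU1 xNc exprS mulN1r.
Qed.

(** As [V] is closed downwards, a chain leaves [V] exactly when its greatest
    element does. *)
Lemma sum_chains_not_sub V : down_closed V ->
  \sum_(c | is_chain c && ~~ (c \subset V)) chain_weight c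
    = \sum_(x in ~: V) \sum_(c | is_chain c && is_greatest x c) chain_weight c.
Proof.
move=> dV.
rewrite [RHS](exchange_big_dep (fun c => is_chain c && ~~ (c \subset V))) /=.
  apply: eq_bigr => c /andP[cc cNV].
  have [|x gr_x] := chain_has_greatest cc.
    by apply: contraNneq cNV => ->; rewrite sub0set.
  (* For a fixed chain, its greatest element is the only index [x] left. *)
  rewrite (big_pred1 x) // => y /=; rewrite inE cc /=.
  apply/andP/eqP => [[_ gr_y]|->]; first exact: greatest_uniq gr_y gr_x.
  split=> //; apply: contraNN cNV => xV; apply/subsetP => z zc.
  by case/andP: gr_x => _ /forall_inP/(_ z zc); apply: dV.
move=> x c; rewrite inE => xNV /andP[-> /andP[xc _]] /=.
by apply: contraNN xNV => /subsetP; apply.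
Qed.

End ChainSums.

Theorem proposition4p7 (d : Order.disp_t) (X : finPOrderType d) (V : {set X})
  (hV : down_closed V) :
  mobius [set: X] = mobius V - \sum_(x in [set: X] :\: V) mobius (Uhat x).
Proof.
rewrite (mobius_sum V) mobius_sum [LHS](bigID (fun c : {set X} => c \subset V)) /=.
congr (_ + _); first by apply: eq_bigl => c; rewrite !inE subsetT andbC.
rewrite setTD -sumrN; under [RHS]eq_bigr do rewrite -sum_chains_greatest.
rewrite -sum_chains_not_sub //.
by apply: eq_bigl => c; rewrite !inE subsetT.
Qed.
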